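(* Let $b$ be a geometric structure on a manifold $M$, and $\{\cdot,\cdot\}_{b,skew}$ the associated skew-symmetric $b$-bracket. Then (i) $\{\cdot,\cdot\}_{b,skew}$ is an almost Poisson bracket (i.e., a skew-symmetric Leibniz bracket), and hence $(M,\{\cdot,\cdot\}_{b,skew})$ is an almost Poisson manifold; (ii) for any fixed $F\in\mathcal{C}^{\infty}(M,\mathbb{R})$, the associated Hamilton–Poisson vector field, $X_F:=\{\cdot,F\}_{b,skew}$, is given by $\dfrac{1}{2}\left(\nabla_{b}^{L}F-\nabla_{b}^{R}F\right)$.
   Context: All manifolds are connected, Hausdorff, paracompact and smooth; all maps are smooth. A geometric structure on a manifold $M$ is a non-degenerate $(0,2)$-tensor field $b:\mathfrak{X}(M)\times\mathfrak{X}(M)\to\mathcal{C}^{\infty}(M,\mathbb{R})$ (no symmetry is assumed). For $F\in\mathcal{C}^{\infty}(M,\mathbb{R})$, the left-gradient $\nabla^{L}_{b}F$ and the right-gradient $\nabla^{R}_{b}F$ are the vector fields uniquely defined by $b(\nabla^{L}_{b}F,X)=\mathrm{d}F\cdot X$ and $b(X,\nabla^{R}_{b}F)=\mathrm{d}F\cdot X$ for all $X\in\mathfrak{X}(M)$. The $b$-bracket is $\{F,G\}_b:=b(\nabla_{b}^{L}F,\nabla_{b}^{L}G)=b(\nabla_{b}^{R}F,\nabla_{b}^{R}G)$ (the two expressions agree), and the skew-symmetric $b$-bracket is $\{F,G\}_{b,skew}:=\frac{1}{2}\left(\{F,G\}_{b}-\{G,F\}_{b}\right)$. A Leibniz bracket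 on $\mathcal{C}^{\infty}(M,\mathbb{R})$ is an $\mathbb{R}$-bilinear map $\mathcal{C}^{\infty}(M,\mathbb{R})\times\mathcal{C}^{\infty}(M,\mathbb{R})\to\mathcal{C}^{\infty}(M,\mathbb{R})$ which is a derivation in each entry; an almost Poisson manifold is a manifold together with an almost Poisson bracket. The Hamilton–Poisson vector field $X_F$ is the derivation $G\mapsto\{G,F\}_{b,skew}$, where vector fields are identified with derivations via $X(G)=\mathrm{d}G\cdot X$. *)

(* Defs.v *)
From HB Require Import structures.
From mathcomp Require Import all_boot all_order all_algebra.
From mathcomp Require Import all_classical all_reals all_analysis.

Set Implicit Arguments.
Unset Strict Implicit.
Unset Printing Implicit Defensive.

Import Order.TTheory GRing.Theory Num.Theory.
Import numFieldNormedType.Exports.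

Local Open Scope classical_set_scope.
Local Open Scope ring_scope.

Section SmoothOn.
Variables (R : realType) (m : nat).
Implicit Types (U : set 'rV[R]_m) (W : normedModType R).

Fixpoint Ck W k U (f : 'rV[R]_m -> W) : Prop :=
  if k is k'.+1 then
    (forall x, U x -> differentiable f x) /\ (forall v, Ck k' U ('D_v f))
  else forall x, U x -> {for x, continuous f}.

Definition smooth_on W U (f : 'rV[R]_m -> W) : Prop := forall k, Ck k U f.

Lemma near_diff W (f g : 'rV[R]_m -> W) x :
  (\forall y \near x, f y = g y) -> differentiable f x ->
  differentiable g x /\ 'd g x = 'd f x :> (_ -> _).
Proof.
move=> fg df.
have fgx : f x = g x by exact: nbhs_singleton fg.
have dfc : continuous ('d f x) by exact: diff_continuous.
have dg : g \o shift x = cst (g x) + 'd f x +o_ 0 id.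
  have /diff_locally /eqaddoP df0 := df.
  apply/eqaddoP => e e0; have := df0 e e0.
  rewrite (near_shift 0) /= subr0 in fg.
  apply: filterS2 fg => y /=; rewrite !fctE /= => <-.
  by rewrite fgx.
have dgE := diff_unique dfc dg.
split; last exact: dgE.
by apply/diff_locallyP; split; [rewrite dgE|rewrite dgE].
Qed.

Lemma near_derive W (f g : 'rV[R]_m -> W) x v :
  (\forall y \near x, f y = g y) -> differentiable f x ->
  'D_v g x = 'D_v f x.
Proof.
move=> fg df; have [dg E] := near_diff fg df.
rewrite (deriveE v dg) (deriveE v df).
exact: (congr1 (fun h => h v) E).
Qed.

Lemma eq_Ck W k U (f g : 'rV[R]_m -> W) : open U ->
  (forall x, U x -> f x = g x) -> Ck k U f -> Ck k U g.
Proof.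
move=> Uo; elim: k f g => [|k IH] f g fg;
  have nfg x : U x -> \forall y \near x, f y = g y
    by move=> Ux; apply: filterS (open_nbhs_nbhs (conj Uo Ux)) => y /fg.
  move=> cf x Ux; have cfx : f @ x --> f x := cf x Ux.
  change (g @ x --> g x); rewrite -(fg x Ux).
  by apply: cvg_trans cfx; apply: (near_eq_cvg (nfg x Ux)).
move=> [df Df]; split => [x Ux|v].
  by have [] := near_diff (nfg x Ux) (df x Ux).
apply: IH (Df v) => x Ux.
by rewrite (near_derive _ (nfg x Ux) (df x Ux)).
Qed.

Lemma eq_smooth_on W U (f g : 'rV[R]_m -> W) : open U ->
  (forall x, U x -> f x = g x) -> smooth_on U f -> smooth_on U g.
Proof. by move=> Uo fg sf k; exact: eq_Ck (sf k). Qed.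

Lemma CkW W k U (f : 'rV[R]_m -> W) : Ck k.+1 U f -> Ck k U f.
Proof.
elim: k f => [|k IH] f [df Df]; first by move=> x /df /differentiable_continuous.
by split=> // v; exact: IH (Df v).
Qed.

Lemma Ck_cst W k U (w : W) : Ck k U (cst w).
Proof.
elim: k w => [|k IH] w /=; first by move=> x _; exact: cst_continuous.
split => [x _|v]; first exact: differentiable_cst.
rewrite (_ : 'D_v _ = cst 0); first exact: IH.
by apply/funext => x; rewrite derive_cst.
Qed.

Lemma CkD W k U (f g : 'rV[R]_m -> W) : open U ->
  Ck k U f -> Ck k U g -> Ck k U (f + g).
Proof.
move=> Uo; elim: k f g => [|k IH] f g /=.
  by move=> cf cg x Ux; apply: continuousD; [exact: cf|exact: cg].
move=> [df Df] [dg Dg]; split => [x Ux|v].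
  by apply: differentiableD; [exact: df|exact: dg].
apply: (eq_Ck Uo _ (IH _ _ (Df v) (Dg v))) => x Ux.
by rewrite deriveD; [|exact/diff_derivable/df|exact/diff_derivable/dg].
Qed.

Lemma CkZ W k U (a : R) (f : 'rV[R]_m -> W) : open U ->
  Ck k U f -> Ck k U (a *: f).
Proof.
move=> Uo; elim: k f => [|k IH] f /=.
  by move=> cf x Ux; exact: (cvgZl_tmp (cf x Ux)).
move=> [df Df]; split => [x Ux|v].
  by apply: differentiableZ; exact: df.
apply: (eq_Ck Uo _ (IH _ (Df v))) => x Ux.
by rewrite deriveZ; last exact/diff_derivable/df.
Qed.

Lemma CkM k U (f g : 'rV[R]_m -> R) : open U ->
  Ck k U f -> Ck k U g -> Ck k U (f * g).
Proof.
move=> Uo; elim: k f g => [|k IH] f g.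
  by move=> /= cf cg x Ux; apply: continuousM; [exact: cf|exact: cg].
move=> /[dup] /CkW cf [df Df] /[dup] /CkW cg [dg Dg]; split => [x Ux|v].
  by apply: differentiableM; [exact: df|exact: dg].
apply: (eq_Ck Uo _ (CkD Uo (IH _ _ cf (Dg v)) (IH _ _ cg (Df v)))) => x Ux.
by rewrite deriveM; [|exact/diff_derivable/df|exact/diff_derivable/dg].
Qed.

Lemma Ck_coord k U l (f : 'rV[R]_m -> 'rV[R]_l) j : open U ->
  Ck k U f -> Ck k U (fun x => f x 0 j).
Proof.
move=> Uo; elim: k f => [|k IH] f /=.
  move=> cf x Ux.
  exact: (continuous_comp (cf x Ux) (@coord_continuous _ _ _ 0 j _)).
move=> [df Df]; split => [x Ux|v].
  exact: (differentiable_comp (df x Ux) (differentiable_coord (f x) 0 j)).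
apply: (eq_Ck Uo _ (IH _ (Df v))) => x Ux.
by rewrite derive_mx ?mxE//; exact/diff_derivable/df.
Qed.

Lemma smooth_on_sum U (I : Type) (r : seq I) (f : I -> 'rV[R]_m -> R) : open U ->
  (forall i, smooth_on U (f i)) -> smooth_on U (fun x => \sum_(i <- r) f i x).
Proof.
move=> Uo sf k; elim: r => [|i r IH].
  by apply: (eq_Ck Uo _ (@Ck_cst R k U 0)) => x _; rewrite big_nil.
apply: (eq_Ck Uo _ (CkD Uo (sf i k) IH)) => x _.
by rewrite big_cons.
Qed.

End SmoothOn.

Definition locally_finite (T : topologicalType) (D : set (set T)) : Prop :=
  forall x : T, exists2 N, nbhs x N & finite_set [set A | D A /\ A `&` N !=set0].

Definition open_covering (T : topologicalType) (C : set (set T)) : Prop :=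
  (forall A, C A -> open A) /\ \bigcup_(A in C) A = [set: T].

Definition paracompact (T : topologicalType) : Prop :=
  forall C : set (set T), open_covering C ->
  exists D : set (set T), [/\ open_covering D, locally_finite D &
    forall A, D A -> exists2 B, C B & A `<=` B].

Section Manifold.
Variables (R : realType) (n : nat).

(* [cinv] is total, but only its values on [cmap @` cdom] are meaningful. *)
Record chart (T : topologicalType) := Chart {
  cdom : set T;
  cmap :> T -> 'rV[R]_n;
  cinv : 'rV[R]_n -> T;
  cdom_open : open cdom;
  cimg_open : open (cmap @` cdom);
  cmapK : forall p, cdom p -> cinv (cmap p) = p;
  cmap_continuous : forall p, cdom p -> {for p, continuous cmap};
  cinv_continuous : forall p, cdom p -> {for cmap p, continuous cinv} }.

Arguments cdom_open {T} c.
Arguments cimg_open {T} c.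

(* The smooth structure is given by an atlas, not necessarily maximal, together
   with a choice [mchart p] of a chart of the atlas around each point [p]. *)
Record manifold := Manifold {
  mspace :> topologicalType;
  mhausdorff : hausdorff_space mspace;
  mconnected : connected [set: mspace];
  mparacompact : paracompact mspace;
  matlas : set (chart mspace);
  mchart : mspace -> chart mspace;
  mchart_atlas : forall p, matlas (mchart p);
  mchart_dom : forall p, cdom (mchart p) p;
  mcompat : forall c d, matlas c -> matlas d ->
    smooth_on (c @` (cdom c `&` cdom d)) (d \o cinv c) }.

Variable M : manifold.
Implicit Types (p q : M) (c d e : chart M).

(* Change of coordinates for tangent vectors: the vector at [p] with coordinates
   [v] in the chart [c] has coordinates [tchange c d p v] in the chart [d]. *)
Definition tchange c d p (v : 'rV[R]_n) : 'rV[R]_n := 'D_v (d \o cinv c) (c p).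

Lemma overlap_open c d : open (c @` (cdom c `&` cdom d)).
Proof.
have -> : c @` (cdom c `&` cdom d) = c @` cdom c `&` cinv c @^-1` cdom d.
  apply/seteqP; split => [_ [p [cp dp] <-]|_ [[p cp <-]]] /=.
    by rewrite cmapK//; split => //; exists p.
  by rewrite cmapK// => dp; exists p.
rewrite openE => _ [[p cp <-] dp].
have {}dp : cdom d p by move: dp; rewrite /= cmapK.
suff: nbhs (c p) (c @` cdom c `&` cinv c @^-1` cdom d) by [].
apply: filterI.
  by apply: open_nbhs_nbhs; split; [exact: cimg_open|exists p].
apply: (cinv_continuous cp); rewrite cmapK//.
by apply: open_nbhs_nbhs; split => //; exact: cdom_open.
Qed.

Lemma near_overlap c d p : cdom c p -> cdom d p ->
  \forall x \near c p, (c @` (cdom c `&` cdom d)) x.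
Proof.
move=> cp dp; apply: open_nbhs_nbhs; split; first exact: overlap_open.
by exists p.
Qed.

Lemma diff_compat c d p : matlas c -> matlas d -> cdom c p -> cdom d p ->
  differentiable (d \o cinv c) (c p).
Proof. by move=> cA dA cp dp; apply: (mcompat cA dA 1%N).1; exists p. Qed.

Lemma derive_chart (W : normedModType R) (f : M -> W) c d p v :
  matlas c -> matlas d -> cdom c p -> cdom d p ->
  differentiable (f \o cinv d) (d p) ->
  'D_v (f \o cinv c) (c p) = 'D_(tchange c d p v) (f \o cinv d) (d p).
Proof.
move=> cA dA cp dp df.
have dE : d p = (d \o cinv c) (c p) by rewrite /= cmapK.
have dcd := diff_compat cA dA cp dp.
have df' : differentiable (f \o cinv d) ((d \o cinv c) (c p)) by rewrite -dE.
have fE : \forall x \near c p,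
    ((f \o cinv d) \o (d \o cinv c)) x = (f \o cinv c) x.
  apply: filterS (near_overlap cp dp) => _ [q [cq dq] <-] /=.
  by rewrite !cmapK.
have dfc : differentiable ((f \o cinv d) \o (d \o cinv c)) (c p).
  exact: differentiable_comp dcd df'.
rewrite (near_derive v fE dfc) (deriveE v dfc) (deriveE _ df).
transitivity ('d (f \o cinv d) ((d \o cinv c) (c p)) ('d (d \o cinv c) (c p) v)).
  exact: (congr1 (fun h => h v) (diff_comp dcd df')).
rewrite -dE; congr ('d _ _ _).
by rewrite /tchange (deriveE v dcd).
Qed.

Lemma tchange_comp c d e p v : matlas c -> matlas d -> matlas e ->
  cdom c p -> cdom d p -> cdom e p ->
  tchange d e p (tchange c d p v) = tchange c e p v.
Proof.
move=> cA dA eA cp dp ep.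
by rewrite /tchange [RHS](derive_chart _ cA dA)//; exact: diff_compat.
Qed.

Lemma tchange_id c p v : cdom c p -> tchange c c p v = v.
Proof.
move=> cp; rewrite /tchange -[RHS](derive_id (c p) v).
apply: near_derive; last exact: ex_diff.
apply: filterS (near_overlap cp cp) => _ [q [cq _] <-] /=.
by rewrite cmapK.
Qed.

Lemma tchange_linear c d p : matlas c -> matlas d -> cdom c p -> cdom d p ->
  linear (tchange c d p).
Proof.
move=> cA dA cp dp a u v; have dcd := diff_compat cA dA cp dp.
by rewrite /tchange !(deriveE _ dcd) linearP.
Qed.


Definition smooth_fun : {pred M -> R} := fun F =>
  `[< forall c, matlas c -> smooth_on (c @` cdom c) (F \o cinv c) >].

Record smoothFun := SmoothFun {
  sf_val :> M -> R;
  sf_valP : sf_val \in smooth_fun }.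

HB.instance Definition _ := [isSub for sf_val].
HB.instance Definition _ := [Choice of smoothFun by <:].

Lemma smooth_fun_subring_closed : subring_closed smooth_fun.
Proof.
split=> [|F G /asboolP sF /asboolP sG|F G /asboolP sF /asboolP sG];
  apply/asboolP => c cA k.
- exact: (@Ck_cst _ _ R).
- apply: (eq_Ck (cimg_open c) _ (CkD (cimg_open c) (sF c cA k)
    (CkZ (-1) (cimg_open c) (sG c cA k)))) => x _.
  by rewrite !fctE /= scaleN1r.
- exact: (CkM (cimg_open c) (sF c cA k) (sG c cA k)).
Qed.

HB.instance Definition _ := GRing.isSubringClosed.Build (M -> R) smooth_fun
  smooth_fun_subring_closed.
HB.instance Definition _ :=
  GRing.SubChoice_isSubComPzRing.Build (M -> R) smooth_fun smoothFun
    smooth_fun_subring_closed.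

Lemma smooth_fun_scaler_closed : scaler_closed smooth_fun.
Proof.
move=> a F /asboolP sF; apply/asboolP => c cA k.
exact: (CkZ (W := R) a (cimg_open c) (sF c cA k)).
Qed.

HB.instance Definition _ := GRing.isScaleClosed.Build R (M -> R^o) smooth_fun
  smooth_fun_scaler_closed.
HB.instance Definition _ := [SubZmodule_isSubLmodule of smoothFun by <:].

Lemma tchangeE c d p v : matlas c -> matlas d -> cdom c p -> cdom d p ->
  tchange c d p v = 'd (d \o cinv c) (c p) v.
Proof. by move=> cA dA cp dp; rewrite /tchange deriveE//; exact: diff_compat. Qed.

(* The tangent space at [p] is R^n, a tangent vector being identified with its
   coordinates in the chart [mchart p]; [vcoord X c] is the expression of the
   field [X] in the chart [c], as a function on the image of [c]. *)
Definition vcoord (X : M -> 'rV[R]_n) c (x : 'rV[R]_n) : 'rV[R]_n :=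
  let p := cinv c x in tchange (mchart p) c p (X p).

Definition smooth_vfield : {pred M -> 'rV[R]_n} := fun X =>
  `[< forall c, matlas c -> smooth_on (c @` cdom c) (vcoord X c) >].

Record vfield := VField {
  vf_val :> M -> 'rV[R]_n;
  vf_valP : vf_val \in smooth_vfield }.

HB.instance Definition _ := [isSub for vf_val].
HB.instance Definition _ := [Choice of vfield by <:].

Lemma smooth_vfield_submod_closed : submod_closed smooth_vfield.
Proof.
split=> [|a X Y /asboolP sX /asboolP sY]; apply/asboolP => c cA k.
  apply: (eq_Ck (cimg_open c) _ (Ck_cst k _ 0)) => _ [p cp <-].
  rewrite /vcoord cmapK// tchangeE ?linear0//;
    by [exact: mchart_atlas|exact: mchart_dom].
apply: (eq_Ck (cimg_open c) _
  (CkD (cimg_open c) (CkZ a (cimg_open c) (sX c cA k)) (sY c cA k))).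
move=> _ [p cp <-]; rewrite !fctE /vcoord /= !cmapK//.
by rewrite tchange_linear//; [exact: mchart_atlas|exact: mchart_dom].
Qed.

HB.instance Definition _ := GRing.isSubmodClosed.Build R (M -> 'rV[R]_n)
  smooth_vfield smooth_vfield_submod_closed.
HB.instance Definition _ := [SubChoice_isSubLmodule of vfield by <:].

Implicit Types (F G : smoothFun) (X Y : vfield).

(* dF.X *)
Definition dapp_val F X (p : M) : R :=
  'D_(X p) (F \o cinv (mchart p)) (mchart p p).

Lemma dapp_subproof F X : dapp_val F X \in smooth_fun.
Proof.
have /asboolP sF := sf_valP F; have /asboolP sX := vf_valP X.
apply/asboolP => c cA.
apply: (@eq_smooth_on _ _ _ _ (fun x => \sum_(i <- index_enum 'I_n)
    vcoord X c x 0 i * 'D_(delta_mx 0 i) (F \o cinv c) x)).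
- exact: cimg_open.
- move=> _ [p cp <-].
  have dF : differentiable (F \o cinv c) (c p) by apply: (sF c cA 1%N).1; exists p.
  rewrite /= cmapK// /dapp_val (derive_chart _ (mchart_atlas p) cA)//;
    last exact: mchart_dom.
  rewrite -[in RHS](cmapK cp) -/(vcoord X c (c p)) cmapK//.
  rewrite [in RHS](row_sum_delta (vcoord X c (c p))) deriveE// linear_sum.
  by apply: eq_bigr => i _; rewrite linearZ deriveE.
- apply: smooth_on_sum; first exact: cimg_open.
  move=> i k; apply: CkM; first exact: cimg_open.
    by apply: Ck_coord; [exact: cimg_open|exact: sX].
  exact: (sF c cA k.+1).2.
Qed.

Definition dapp F X : smoothFun := SmoothFun (dapp_subproof F X).

(* A (0,2)-tensor field is smooth when its components in each chart are; here
   the constant vectors [v] and [w] are read in the chart [c]. *)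
Record geomStructure := GeomStructure {
  gs_form :> M -> {biscalar 'rV[R]_n};
  gs_smooth : forall c v w, matlas c ->
    smooth_on (c @` cdom c) (fun x => let p := cinv c x in
      gs_form p (tchange c (mchart p) p v) (tchange c (mchart p) p w));
  gs_nondegl : forall p v, (forall w, gs_form p v w = 0) -> v = 0;
  gs_nondegr : forall p w, (forall v, gs_form p v w = 0) -> w = 0 }.

Variable b : geomStructure.

Definition gs_app_val X Y (p : M) : R := b p (X p) (Y p).

Lemma gs_app_subproof X Y : gs_app_val X Y \in smooth_fun.
Proof.
have /asboolP sX := vf_valP X; have /asboolP sY := vf_valP Y.
apply/asboolP => c cA.
pose e i : 'rV[R]_n := delta_mx 0 i.
apply: (@eq_smooth_on _ _ _ _ (fun x => \sum_(i <- index_enum 'I_n)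
  \sum_(j <- index_enum 'I_n) vcoord X c x 0 i * (vcoord Y c x 0 j *
    let p := cinv c x in
    b p (tchange c (mchart p) p (e i)) (tchange c (mchart p) p (e j))))).
- exact: cimg_open.
- move=> _ [p cp <-] /=; rewrite cmapK// /gs_app_val.
  have XE (Z : vfield) : Z p = \sum_(i <- index_enum 'I_n)
      vcoord Z c (c p) 0 i *: tchange c (mchart p) p (e i).
    have [pA pp] := (mchart_atlas p, mchart_dom p).
    rewrite -[LHS](tchange_id _ pp) -(tchange_comp _ pA cA pA pp cp pp).
    have -> : tchange (mchart p) c p (Z p) = vcoord Z c (c p).
      by rewrite /vcoord cmapK.
    rewrite [in LHS](row_sum_delta (vcoord Z c (c p))) tchangeE// linear_sum.
    by apply: eq_bigr => i _; rewrite linearZ tchangeE.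
  rewrite [in RHS](XE X) [in RHS](XE Y) linear_sumlz.
  apply: eq_bigr => i _; rewrite linearZl_LR linear_sumr -mulr_sumr.
  by congr (_ * _); apply: eq_bigr => j _; rewrite linearZr_LR.
- apply: smooth_on_sum; first exact: cimg_open.
  move=> i; apply: smooth_on_sum; first exact: cimg_open.
  move=> j k; apply: CkM; first exact: cimg_open.
    by apply: Ck_coord; [exact: cimg_open|exact: sX].
  apply: CkM; first exact: cimg_open.
    by apply: Ck_coord; [exact: cimg_open|exact: sY].
  exact: gs_smooth.
Qed.

Definition gs_app X Y : smoothFun := SmoothFun (gs_app_subproof X Y).

(* Nondegeneracy makes the two gradients exist and be unique; [0] is only the
   value [xget] would return on an empty set. *)
Definition left_gradient F : vfield :=
  xget 0 [set Y | forall X, gs_app Y X = dapp F X].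

Definition right_gradient F : vfield :=
  xget 0 [set Y | forall X, gs_app X Y = dapp F X].

Definition b_bracket F G : smoothFun :=
  gs_app (left_gradient F) (left_gradient G).

Definition skew_b_bracket F G : smoothFun :=
  2^-1 *: (b_bracket F G - b_bracket G F).

Definition vfield_derivation X : smoothFun -> smoothFun := fun G => dapp G X.

Definition hamilton_poisson F : smoothFun -> smoothFun :=
  fun G => skew_b_bracket G F.

Definition leibniz_bracket (B : smoothFun -> smoothFun -> smoothFun) : Prop :=
  [/\ forall G, linear (B^~ G),
      forall F, linear (B F),
      forall F1 F2 G, B (F1 * F2) G = F1 * B F2 G + B F1 G * F2 &
      forall F G1 G2, B F (G1 * G2) = G1 * B F G2 + B F G1 * G2].

Definition almost_poisson_bracket (B : smoothFun -> smoothFun -> smoothFun) :=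
  leibniz_bracket B /\ forall F G, B F G = - B G F.

Definition almost_poisson_manifold (B : smoothFun -> smoothFun -> smoothFun) :=
  almost_poisson_bracket B.

End Manifold.

Arguments almost_poisson_manifold {R n} M B.

(* Main.v *)
From HB Require Import structures.
Require Import Defs.
From mathcomp Require Import all_boot all_order all_algebra.
From mathcomp Require Import all_classical all_reals all_analysis.

Import GRing.Theory Num.Theory.
Import numFieldNormedType.Exports.

Local Open Scope classical_set_scope.
Local Open Scope ring_scope.

(** Evaluating [b] on a left and a right gradient gives
      [dF (left_gradient G) = b (left_gradient G) (right_gradient F)
                            = dG (right_gradient F)],
    and the left side is [b_bracket F G] by the defining property of
    [left_gradient F]. Applying the first expression to [b_bracket F G] and the
    second to [b_bracket G F] turns the skew bracket into
      [dF (2^-1 *: (left_gradient G - right_gradient G))]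
    ([skew_b_bracketE]). This is the formula for the Hamilton-Poisson field, and
    it makes the bracket a derivation in its first argument; skew-symmetry
    transfers linearity and the Leibniz rule to the second one.

    The analytic content is that the gradients exist as smooth vector fields
    ([left_gradientP], [right_gradientP]). In a chart the left gradient has to be
    the row of partial derivatives of [F] times the inverse of the Gram matrix
    of [b]. Nondegeneracy makes this matrix invertible ([gram_unit]), so
    that Cramer's formula yields smooth entries ([smooth_on_invmx]), and it also
    makes the local expressions agree on overlaps ([grad_coord_chart]), because
    each of them represents the same covector dF ([grad_coordP]). Right
    gradients are the left gradients of the transposed structure. *)

(** * Smoothness of matrix operations *)

Section SmoothMatrix.
Context {R : realType} {m : nat}.
Implicit Types (U : set 'rV[R]_m) (f g : 'rV[R]_m -> R).

Lemma smooth_onM U f g : open U ->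
  smooth_on U f -> smooth_on U g -> smooth_on U (fun x => f x * g x).
Proof. by move=> Uo sf sg k; exact: CkM. Qed.

Lemma smooth_on_prod U (I : Type) (r : seq I) (f : I -> 'rV[R]_m -> R) :
  open U -> (forall i, smooth_on U (f i)) ->
  smooth_on U (fun x => \prod_(i <- r) f i x).
Proof.
move=> Uo sf; elim: r => [|i r IH].
  by apply: (@eq_smooth_on _ _ R^o _ (cst (1 : R))) => [//|x _|k];
    [rewrite big_nil|exact: (@Ck_cst _ _ R)].
apply: (@eq_smooth_on _ _ _ _ (fun x => f i x * \prod_(j <- r) f j x)) => //.
  by move=> x _; rewrite big_cons.
exact: smooth_onM.
Qed.

Lemma smooth_on_inv U f : open U -> (forall x, U x -> f x != 0) ->
  smooth_on U f -> smooth_on U (fun x => (f x)^-1).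
Proof.
move=> Uo f0 sf; elim=> [|k IH].
  by move=> x Ux; apply: continuousV; [exact: f0|exact: (sf 0%N)].
have [df Df] := sf k.+1; split=> [x Ux|v].
  by apply: differentiableV; [exact: df|exact: f0].
(* The quotient rule (1/f)' = - (1/f)^2 f' expresses the derivative of order
   k+1 of 1/f by derivatives of order at most k of 1/f and f'. *)
apply: (eq_Ck Uo _ (CkZ (-1) Uo (CkM Uo (CkM Uo IH IH) (Df v)))) => x Ux.
rewrite deriveV; [|exact: f0|exact/diff_derivable/df].
change (-1 * ((f x)^-1 * (f x)^-1 * 'D_v f x) = - f x ^- 2 * 'D_v f x).
by rewrite mulN1r expr2 invfM mulNr.
Qed.

Lemma smooth_on_scalel (W : normedModType R) U f (w : W) : open U ->
  smooth_on U f -> smooth_on U (fun x => f x *: w).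
Proof.
move=> Uo + k => /(_ k); elim: k f => [|k IH] f /=.
  by move=> cf x Ux; exact: (cvgZr_tmp (a := w) (cf x Ux)).
move=> [df Df]; split=> [x Ux|v].
  by apply: differentiableZl; exact: df.
apply: (eq_Ck Uo _ (IH _ (Df v))) => x Ux.
have dfx := df _ Ux.
by rewrite !deriveE ?diffZl//; exact: differentiableZl.
Qed.

Lemma smooth_on_row l U (f : 'rV[R]_m -> 'rV[R]_l) : open U ->
  (forall j, smooth_on U (fun x => f x 0 j)) -> smooth_on U f.
Proof.
move=> Uo sf k.
have fE : f = fun x => \sum_(j <- index_enum 'I_l) f x 0 j *: delta_mx 0 j.
  by apply/funext => x; rewrite -row_sum_delta.
rewrite fE; elim: (index_enum _) => [|j r IH].
  by apply: (eq_Ck Uo _ (Ck_cst k U 0)) => x _; rewrite big_nil.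
apply: (eq_Ck Uo _ (CkD Uo (smooth_on_scalel _ _ _ (delta_mx 0 j) Uo (sf j) k) IH)).
by move=> x _; rewrite big_cons.
Qed.

Lemma smooth_on_det l U (A : 'rV[R]_m -> 'M[R]_l) : open U ->
  (forall i j, smooth_on U (fun x => A x i j)) ->
  smooth_on U (fun x => \det (A x)).
Proof.
move=> Uo sA; rewrite /determinant; apply: smooth_on_sum => // s.
apply: smooth_onM => //; first by move=> k; exact: (@Ck_cst _ _ R).
by apply: smooth_on_prod.
Qed.

(** By Cramer's formula the entries of the inverse are cofactors divided by the
    determinant, hence polynomials in the entries of [A] over a nonvanishing
    polynomial. *)
Lemma smooth_on_invmx l U (A : 'rV[R]_m -> 'M[R]_l) : open U ->
  (forall x, U x -> A x \in unitmx) ->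
  (forall i j, smooth_on U (fun x => A x i j)) ->
  forall i j, smooth_on U (fun x => invmx (A x) i j).
Proof.
move=> Uo uA sA i j.
apply: (@eq_smooth_on _ _ _ _ (fun x => (\det (A x))^-1 *
  ((-1) ^+ (j + i) * \det (row' j (col' i (A x)))))) => //.
  by move=> x Ux; rewrite /invmx uA// !mxE.
apply: smooth_onM => //.
  apply: smooth_on_inv => // [x /uA|]; first by rewrite unitmxE unitfE.
  exact: smooth_on_det.
apply: smooth_onM => //; first by move=> k; exact: (@Ck_cst _ _ R).
apply: smooth_on_det => // i' j'.
by apply: (eq_smooth_on Uo _ (sA (lift j i') (lift i j'))) => x _; rewrite !mxE.
Qed.

End SmoothMatrix.

(** * Existence of smooth gradients *)

Section Gradients.
Context {R : realType} {n : nat} {M : manifold R n}.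
Implicit Types (b : geomStructure M) (F : smoothFun M) (X : vfield M).
Implicit Types (p : M) (c : chart R n M) (v w : 'rV[R]_n).

Lemma smooth_chart_diff F c p : matlas c -> cdom c p ->
  differentiable (F \o cinv c) (c p).
Proof.
by move=> cA cp; have /asboolP/(_ c cA 1%N)[+ _] := sf_valP F; apply; exists p.
Qed.

Definition gram b c p : 'M[R]_n := \matrix_(i, j)
  b p (tchange c (mchart p) p (delta_mx 0 i))
      (tchange c (mchart p) p (delta_mx 0 j)).

Definition partials F c p : 'rV[R]_n :=
  \row_j 'D_(delta_mx 0 j) (F \o cinv c) (c p).

(** Coordinates in the chart [c] of the left gradient: the solution [v] of
    [v *m gram = partials], where [v] multiplies on the left because it is the
    first argument of the form. *)
Definition grad_coord b F c p : 'rV[R]_n := partials F c p *m invmx (gram b c p).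

Lemma tchangeK c d p : matlas c -> matlas d -> cdom c p -> cdom d p ->
  cancel (tchange c d p) (tchange d c p).
Proof. by move=> cA dA cp dp v; rewrite tchange_comp// tchange_id. Qed.

Section AtPoint.
Variables (b : geomStructure M) (c : chart R n M) (p : M).
Hypotheses (cA : matlas c) (cp : cdom c p).
Let mA := mchart_atlas p.
Let mp := mchart_dom p.

Lemma gramE v w :
  b p (tchange c (mchart p) p v) (tchange c (mchart p) p w) =
  (v *m gram b c p *m w^T) 0 0.
Proof.
have tE u : tchange c (mchart p) p u =
    \sum_i u 0 i *: tchange c (mchart p) p (delta_mx 0 i).
  rewrite [in LHS](row_sum_delta u) tchangeE// linear_sum.
  by apply: eq_bigr => i _; rewrite linearZ tchangeE.
rewrite [in LHS](tE w) linear_sumr mxE.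
apply: eq_bigr => j _; rewrite linearZr_LR !mxE mulrC; congr (_ * _).
rewrite (tE v) linear_sumlz; apply: eq_bigr => i _.
by rewrite linearZl_LR !mxE.
Qed.

(** A row vector in the left kernel of the Gram matrix is, by bilinearity, a
    tangent vector in the left kernel of [b]. *)
Lemma gram_unit : gram b c p \in unitmx.
Proof.
rewrite -row_free_unit; apply: inj_row_free => v v0.
rewrite -(tchangeK c (mchart p) p cA mA cp mp v).
suff -> : tchange c (mchart p) p v = 0 by rewrite tchangeE// linear0.
apply: (gs_nondegl (g := b) (p := p)) => w.
rewrite -(tchangeK (mchart p) c p mA cA mp cp w).
by rewrite gramE v0 mul0mx mxE.
Qed.

(** Multiplying [grad_coord] by the Gram matrix leaves the row of partial
    derivatives, whose pairing with a vector is a directional derivative; the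
    chain rule moves it from the chart [c] to the reference chart at [p]. The
    right-hand side does not depend on [c], which is what makes the local
    gradients glue. *)
Lemma grad_coordP F w :
  b p (tchange c (mchart p) p (grad_coord b F c p)) w =
  'D_w (F \o cinv (mchart p)) (mchart p p).
Proof.
have dF := smooth_chart_diff F c p cA cp.
rewrite -{1}(tchangeK (mchart p) c p mA cA mp cp w) gramE.
rewrite /grad_coord mulmxKV ?gram_unit//.
rewrite (derive_chart w mA cA mp cp dF).
set u := tchange _ _ _ _.
rewrite [in RHS](row_sum_delta u) deriveE// linear_sum mxE.
by apply: eq_bigr => j _; rewrite linearZ !mxE deriveE// mulrC.
Qed.

End AtPoint.

(** Read in the reference chart, both sides represent the same covector, so their
    difference is in the left kernel of [b]. *)
Lemma grad_coord_chart b F c p : matlas c -> cdom c p ->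
  tchange (mchart p) c p (grad_coord b F (mchart p) p) = grad_coord b F c p.
Proof.
move=> cA cp; have [mA mp] := (mchart_atlas p, mchart_dom p).
rewrite -[RHS](tchangeK c (mchart p) p cA mA cp mp); congr tchange.
apply/eqP; rewrite -subr_eq0; apply/eqP.
apply: (gs_nondegl (g := b) (p := p)) => w.
rewrite linearBl grad_coordP//.
rewrite -{1}(tchange_id (grad_coord b F (mchart p) p) mp).
by rewrite grad_coordP// subrr.
Qed.

(** The reference chart [mchart p] may vary wildly with [p], so smoothness is not
    visible on the definition; chart independence replaces [mchart p] by a
    fixed chart [c], where [grad_coord] is an explicit smooth expression. *)
Lemma grad_smooth b F :
  (fun p => grad_coord b F (mchart p) p) \in @smooth_vfield R n M.
Proof.
apply/asboolP => c cA; have Uo : open (c @` cdom c) by exact: cimg_open.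
apply: (@eq_smooth_on _ _ _ _ (fun x => grad_coord b F c (cinv c x))) => //.
  by move=> _ [p cp <-]; rewrite /vcoord cmapK// grad_coord_chart.
apply: smooth_on_row => // j.
apply: (@eq_smooth_on _ _ _ _ (fun x => \sum_(i <- index_enum 'I_n)
    'D_(delta_mx 0 i) (F \o cinv c) x * invmx (gram b c (cinv c x)) i j)) => //.
  move=> _ [p cp <-]; rewrite /grad_coord mxE.
  by apply: eq_bigr => i _; rewrite !mxE cmapK.
apply: smooth_on_sum => // i; apply: smooth_onM => //.
  by move=> k; have /asboolP/(_ c cA k.+1)[_ +] := sf_valP F; apply.
apply: smooth_on_invmx => // [_ [p cp <-]|i' j'].
  by rewrite cmapK//; exact: gram_unit.
apply: (eq_smooth_on Uo _ (gs_smooth b (delta_mx 0 i') (delta_mx 0 j') cA)).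
by move=> x _; rewrite mxE.
Qed.

Lemma left_gradientP b F X : gs_app b (left_gradient b F) X = dapp F X.
Proof.
rewrite /left_gradient; move: X.
apply: (@xgetPex _ 0 [set Y | forall X, gs_app b Y X = dapp F X]).
exists (VField (grad_smooth b F)) => X; apply/val_inj/funext => p /=.
rewrite /gs_app_val /dapp_val /=.
have [mA mp] := (mchart_atlas p, mchart_dom p).
by rewrite -{1}(tchange_id (grad_coord b F (mchart p) p) mp) grad_coordP.
Qed.

End Gradients.

(** * The transposed structure *)

Section Transpose.
Context {R : realType} {n : nat} {M : manifold R n}.
Variable b : geomStructure M.

Definition flip_form (p : M) (v w : 'rV[R]_n) : R := b p w v.

Lemma flip_form_bilinear p : bilinear_for
  (GRing.Scale.Law.clone _ _ *%R _) (GRing.Scale.Law.clone _ _ *%R _)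
  (flip_form p).
Proof.
by split=> [w|v] a x y; rewrite /flip_form /= ?linearPr ?linearPl.
Qed.

HB.instance Definition _ p := bilinear_isBilinear.Build R _ _ _ _ _
  (flip_form p) (flip_form_bilinear p).

(** Transparent, so that its form computes to [flip_form]. *)
Definition gs_transpose : geomStructure M.
Proof.
exists (fun p => flip_form p : {biscalar 'rV[R]_n}).
- by move=> c v w; exact: gs_smooth.
- by move=> p v; exact: gs_nondegr.
- by move=> p w; exact: gs_nondegl.
Defined.

Lemma gs_app_transpose X Y : gs_app gs_transpose X Y = gs_app b Y X.
Proof. exact/val_inj. Qed.

Lemma right_gradientE F : right_gradient b F = left_gradient gs_transpose F.
Proof.
congr xget; apply/seteqP; split=> Y /= YP X; first by rewrite gs_app_transpose.
by rewrite -gs_app_transpose.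
Qed.

Lemma right_gradientP F X : gs_app b X (right_gradient b F) = dapp F X.
Proof. by rewrite right_gradientE -gs_app_transpose left_gradientP. Qed.

End Transpose.

(** * The brackets as derivations *)

Section Bracket.
Context {R : realType} {n : nat} {M : manifold R n}.
Implicit Types (b : geomStructure M) (F G : smoothFun M) (X : vfield M).

Lemma dapp_linearl X : linear (fun F => dapp F X).
Proof.
move=> a F G; apply/val_inj/funext => p.
have [mA mp] := (mchart_atlas p, mchart_dom p).
have dF := smooth_chart_diff F _ _ mA mp.
have dG := smooth_chart_diff G _ _ mA mp.
change (dapp_val (a *: F + G) X p = a * dapp_val F X p + dapp_val G X p).
rewrite /dapp_val -[_ * _]/(_ *: _) -deriveZ; last exact/diff_derivable.
by rewrite -deriveD; [|exact/diff_derivable/differentiableZ|exact/diff_derivable].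
Qed.

Lemma dapp_mul X F G : dapp (F * G) X = F * dapp G X + dapp F X * G.
Proof.
apply/val_inj/funext => p.
have [mA mp] := (mchart_atlas p, mchart_dom p).
have dF := smooth_chart_diff F _ _ mA mp.
have dG := smooth_chart_diff G _ _ mA mp.
change (dapp_val (F * G) X p = F p * dapp_val G X p + dapp_val F X p * G p).
rewrite /dapp_val.
change ('D_(X p) ((F \o cinv (mchart p)) * (G \o cinv (mchart p))) (mchart p p) =
  F p * 'D_(X p) (G \o cinv (mchart p)) (mchart p p) +
  'D_(X p) (F \o cinv (mchart p)) (mchart p p) * G p).
rewrite deriveM; [|exact/diff_derivable|exact/diff_derivable].
by rewrite /= cmapK// -![_ *: _]/(_ * _) [in X in _ + X]mulrC.
Qed.

Lemma dapp_linearr F : linear (dapp F).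
Proof.
move=> a X Y; apply/val_inj/funext => p.
have dF := smooth_chart_diff F _ _ (mchart_atlas p) (mchart_dom p).
change (dapp_val F (a *: X + Y) p = a * dapp_val F X p + dapp_val F Y p).
by rewrite /dapp_val !deriveE// linearP.
Qed.

Lemma b_bracketEl b F G : b_bracket b F G = dapp F (left_gradient b G).
Proof. exact: left_gradientP. Qed.

(** The exchange between left and right gradients: by [b_bracketEl], both sides equal
    [gs_app b (left_gradient b G) (right_gradient b F)]. *)
Lemma b_bracketEr b F G : b_bracket b F G = dapp G (right_gradient b F).
Proof. by rewrite b_bracketEl -(right_gradientP b) left_gradientP. Qed.

Lemma skew_b_bracketE b F G : skew_b_bracket b F G =
  dapp F (2^-1 *: (left_gradient b G - right_gradient b G)).
Proof.
rewrite /skew_b_bracket b_bracketEl (b_bracketEr b G F).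
have lin := dapp_linearr F.
by rewrite (scalable_linear lin) (zmod_morphism_linear lin).
Qed.

Lemma skew_b_bracketC b F G : skew_b_bracket b F G = - skew_b_bracket b G F.
Proof. by rewrite /skew_b_bracket -scalerN opprB. Qed.

Lemma skew_b_bracket_almost_poisson b : almost_poisson_bracket (skew_b_bracket b).
Proof.
have linl G : linear ((skew_b_bracket b)^~ G).
  by move=> a F1 F2; rewrite !skew_b_bracketE dapp_linearl.
have mull F1 F2 G : skew_b_bracket b (F1 * F2) G =
    F1 * skew_b_bracket b F2 G + skew_b_bracket b F1 G * F2.
  by rewrite !skew_b_bracketE dapp_mul.
split; last exact: skew_b_bracketC.
split=> // [F a G1 G2|F G1 G2]; rewrite 3!(skew_b_bracketC b F).
  by rewrite linl opprD scalerN.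
by rewrite mull opprD mulrN mulNr.
Qed.

End Bracket.

Theorem proposition3p17 (R : realType) (n : nat) (M : manifold R n)
    (b : geomStructure M) :
  (almost_poisson_bracket (skew_b_bracket b) /\
   almost_poisson_manifold M (skew_b_bracket b)) /\
  (forall F : smoothFun M,
    hamilton_poisson b F =
    vfield_derivation (2^-1 *: (left_gradient b F - right_gradient b F))).
Proof.
have ap := skew_b_bracket_almost_poisson b.
by split=> [//|F]; apply/funext => G; exact: skew_b_bracketE.
Qed.
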